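(* For positive integers $N$ and $r$ and $s_1,\ldots,s_r\in\mathbb C$, \[ \zeta^{\mathrm{sp},N}_{(r)}(s_1,\ldots,s_r)=\sum_{\boldsymbol\ell\in L_r}(-1)^{r-\mathrm{dep}(\boldsymbol\ell)}\,\zeta^{\star N}(\boldsymbol\ell), \] and for $r\ge2$ \[ \zeta^{\mathrm{so},N}_{(r)}(s_1,\ldots,s_r)=\sum_{R=r-1}^{r}\ \sum_{\boldsymbol\ell\in L_R}(-1)^{R-\mathrm{dep}(\boldsymbol\ell)}\,\zeta^{\star N}(\boldsymbol\ell). \] Here $L_R$ is the family (with multiplicity) of all indices $\boldsymbol\ell$ obtained from $\pm s_1\,\square\,\pm s_2\,\square\cdots\square\,\pm s_R$ as follows: each $\square$ is filled by a comma or a plus so that no two consecutive squares are filled by plus; whenever the square between $\pm s_j$ and $\pm s_{j+1}$ is a plus, the two entries $\pm s_j\square\pm s_{j+1}$ are replaced by the single entry $s_{j+1}-s_j$; and for each of the remaining (unmerged) entries $\pm s_j$ a sign is chosen independently.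
   Context: Let $[\overline N]=\{1<\overline1<2<\overline2<\cdots<N<\overline N\}$ and $[\overline N]^\infty=[\overline N]\cup\{\infty\}$ with $\infty$ the largest element; put $|i|=i$, $|\overline i|=i^{-1}$, $|\infty|=1$. For the one-row shape $(r)$, $\zeta^{\mathrm{sp},N}_{(r)}(s_1,\ldots,s_r)=\sum\prod_{j=1}^r|m_j|^{-s_j}$, summed over all $m_1\le m_2\le\cdots\le m_r$ in $[\overline N]$ (symplectic tableaux of a single row); $\zeta^{\mathrm{so},N}_{(r)}(s_1,\ldots,s_r)$ is the same sum over all $m_1\le\cdots\le m_r$ in $[\overline N]^\infty$ with $\infty$ occurring at most once (so-tableaux of a single row). For an index $\boldsymbol\ell=(\ell_1,\ldots,\ell_d)\in\mathbb C^d$, $\mathrm{dep}(\boldsymbol\ell)=d$ and $\zeta^{\star N}(\boldsymbol\ell)=\sum_{1\le m_1\le m_2\le\cdots\le m_d\le N}m_1^{-\ell_1}\cdots m_d^{-\ell_d}$. *)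

(* Defs.v *)
From HB Require Import structures.
From mathcomp Require Import all_boot all_order all_algebra.
From mathcomp Require Import complex.
From mathcomp Require Import reals sequences exp trigo.

Set Implicit Arguments.
Unset Strict Implicit.
Unset Printing Implicit Defensive.

Import Order.TTheory GRing.Theory Num.Theory.

Local Open Scope ring_scope.
Local Open Scope complex_scope.

Section Defs.
Variable R : realType.

Definition cexp (z : R[i]) : R[i] :=
  (expR (complex.Re z))%:C * (cos (complex.Im z) +i* sin (complex.Im z)).

(* x ^ z with the real logarithm of x; only used for x > 0 (ln is 0 on x <= 0). *)
Definition cpow (x : R) (z : R[i]) : R[i] := cexp (z * (ln x)%:C).

(* The alphabet {1 < 1bar < 2 < 2bar < ... < N < Nbar}: (i, false) encodes i + 1
   and (i, true) encodes its barred version; as false < true, the lexicographic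
   order is the order of the alphabet. *)
Definition barred (N : nat) := ('I_N *l bool)%type.

Definition barred_abs (N : nat) (a : barred N) : R :=
  if a.2 then (a.1.+1%:R)^-1 else a.1.+1%:R.

(* None encodes the largest letter infinity. *)
Definition le_barredoo (N : nat) (a b : option (barred N)) : bool :=
  match a, b with
  | _, None => true
  | None, Some _ => false
  | Some x, Some y => (x <= y)%O
  end.

Definition barredoo_abs (N : nat) (a : option (barred N)) : R :=
  if a is Some x then barred_abs x else 1.

Definition zeta_sp (N r : nat) (s : r.-tuple R[i]) : R[i] :=
  \sum_(m : r.-tuple (barred N) | sorted <=%O m)
    \prod_(j < r) cpow (barred_abs (tnth m j)) (- tnth s j).

Definition zeta_so (N r : nat) (s : r.-tuple R[i]) : R[i] :=
  \sum_(m : r.-tuple (option (barred N)) |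
          sorted (@le_barredoo N) m && (count_mem None m <= 1)%N)
    \prod_(j < r) cpow (barredoo_abs (tnth m j)) (- tnth s j).

Definition dep (l : seq R[i]) : nat := size l.

(* The summation variables range over 'I_N, so m_j is (tnth m j).+1. *)
Definition zeta_star (N : nat) (l : seq R[i]) : R[i] :=
  \sum_(m : (dep l).-tuple 'I_N | sorted <=%O m)
    \prod_(j < dep l) cpow (tnth m j).+1%:R (- tnth (in_tuple l) j).

(* A filling of n squares: true is a plus, false is a comma. *)
Definition fillings (n : nat) : seq (seq bool) :=
  [seq tval w | w : n.-tuple bool <- enum {: n.-tuple bool}
              & sorted (fun a b => ~~ (a && b)) w].

(* The list of alternatives for each entry of s once the squares between its
   entries are filled by w. After a plus, the next square is necessarily a
   comma in a filling, and it is skipped by behead. *)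
Fixpoint alternatives (s : seq R[i]) (w : seq bool) : seq (seq R[i]) :=
  match s, w with
  | x :: y :: s', true :: w' => [:: y - x] :: alternatives s' (behead w')
  | x :: s', _ => [:: x; - x] :: alternatives s' (behead w)
  | [::], _ => [::]
  end.

(* All ways of choosing one element in each list of cs. *)
Definition selections (T : Type) (cs : seq (seq T)) : seq (seq T) :=
  foldr (fun c acc => [seq x :: l | x <- c, l <- acc]) [:: [::]] cs.

(* A list rather than a set, since indices are counted with multiplicity. *)
Definition Lfam (s : seq R[i]) : seq (seq R[i]) :=
  flatten [seq selections (alternatives s w) | w <- fillings (size s).-1].

End Defs.

(* Main.v *)
Require Import Defs.
From HB Require Import structures.
From mathcomp Require Import all_boot all_order all_algebra.
From mathcomp Require Import complex.
From mathcomp Require Import reals sequences exp trigo.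

(** The sum over symplectic rows differs from a sum over weakly increasing
    words in the absolute indices by one family of local defects.  Forget the
    bars: a word in the barred alphabet becomes a weakly increasing word
    [n_1 <= ... <= n_r] of integers together with a free choice of bars, and
    the barred word is increasing exactly when no position [j] shows a defect,
    namely [n_j = n_{j+1}] with [n_j] barred and [n_{j+1}] not.  Inclusion and
    exclusion over the defects gives the formula: a letter outside the chosen
    defects contributes the alternatives [+s_j] and [-s_j], a defect at [j]
    contributes the weight [n^{s_j} n^{-s_{j+1}} = n^{-(s_{j+1} - s_j)}] of a
    merged entry with a sign [-1], and two defects cannot overlap, so that no
    two consecutive squares carry a plus.

    This is carried out one letter at a time.  A sum over increasing words is
    written as an iterated sum [chain_sum], which depends on the letter that
    bounds the next one from below.  The letters above [n] barred are those
    above [n] with [n] itself removed, so barred bounds can be eliminated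
    ([chain_sum_bar]), and this yields a two-step recursion
    ([chain_sum_barred_cons2]).  Splitting the fillings according to their first
    square gives the same recursion on the side of the indices
    ([big_Lfam_cons2], [star_sum_cons2]).

    For the orthogonal rows, the letter infinity has weight [1] and can only
    be the last letter, so the rows without it give the symplectic sum for
    [s_1, ..., s_r] and those with it the one for [s_1, ..., s_{r-1}]
    ([chain_sum_infty]). *)

Set Implicit Arguments.
Unset Strict Implicit.
Unset Printing Implicit Defensive.

Import Order.TTheory GRing.Theory Num.Theory.

Local Open Scope ring_scope.
Local Open Scope complex_scope.

(** * Sums over words that follow a relation *)

Lemma big_tuple_cons (T : finType) (C : nmodType) (n : nat)
    (P : pred (n.+1.-tuple T)) (G : n.+1.-tuple T -> C) :
  \sum_(m | P m) G m
  = \sum_(a : T) \sum_(m : n.-tuple T | P [tuple of a :: m])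
      G [tuple of a :: m].
Proof.
rewrite pair_big_dep /=.
rewrite (reindex (fun p : T * n.-tuple T => [tuple of p.1 :: p.2])) //=.
exists (fun m : n.+1.-tuple T => (thead m, [tuple of behead m]))
  => [[a m] _|m _].
  by congr pair; apply: val_inj.
by rewrite /= [RHS]tuple_eta.
Qed.

(** The parameter [a] is the letter that precedes the word; it makes the sum
    over the words a sum over the first letter followed by a sum of the same
    kind. *)
Fixpoint chain_sum (C : comPzRingType) (A : Type) (T : finType) (e : rel T)
    (f : A -> T -> C) (s : seq A) (a : T) : C :=
  if s is x :: s' then \sum_(b | e a b) f x b * chain_sum e f s' b else 1.

Lemma chain_sumE (C : comPzRingType) (A : Type) (T : finType) (e : rel T)
    (f : A -> T -> C) (n : nat) (s : n.-tuple A) (a : T) :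
  \sum_(m : n.-tuple T | path e a m) \prod_(j < n) f (tnth s j) (tnth m j)
  = chain_sum e f s a.
Proof.
elim: n s a => [|n IHn] s a.
  rewrite [s]tuple0 /= (big_pred1 [tuple]) ?big_ord0 // => m.
  by rewrite [m]tuple0 /= eqxx.
case/tupleP: s => x s; rewrite big_tuple_cons /= [RHS]big_mkcond /=.
apply: eq_bigr => b _; case: ifP => eab /=; last by rewrite big_pred0.
rewrite -IHn big_distrr /=; apply: eq_bigr => m _.
rewrite big_ord_recl !tnth0; congr (_ * _).
by apply: eq_bigr => j _; rewrite !tnthS.
Qed.

(** * Increasing words in the barred alphabet *)

Section Barred.
Variables (C : comPzRingType) (A : zmodType) (N : nat) (t : A -> 'I_N -> C).

(** If [t x n] stands for the power of exponent [- x] of an integer, then a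
    bar inverts the integer and hence negates [x]. *)
Definition barred_weight (x : A) (a : barred N) : C :=
  t (if a.2 then - x else x) a.1.

Notation spsum := (chain_sum (<=%O : rel (barred N)) barred_weight).

Lemma le_barredE (n k : 'I_N) (b c : bool) :
  ((n, b) <= (k, c) :> barred N)%O = (n < k)%O || (n == k) && (b ==> c).
Proof.
rewrite Order.ProdLexiOrder.leEprodlexi /=.
have -> : (b <= c)%O = (b ==> c) by case: b c => [] [].
by case: (ltgtP n k).
Qed.

Lemma le_barred_false (n k : 'I_N) (c : bool) :
  ((n, false) <= (k, c) :> barred N)%O = (n <= k)%O.
Proof. by rewrite le_barredE /= andbT orbC -le_eqVlt. Qed.

(** A letter that is at least [n] is either [n] itself or at least [n]
    barred. *)
Lemma chain_sum_bar (x : A) (s : seq A) (n : 'I_N) :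
  spsum (x :: s) (n, true)
  = spsum (x :: s) (n, false) - t x n * spsum s (n, false).
Proof.
rewrite /= [X in _ = X - _](bigD1 ((n, false) : barred N)) //=.
rewrite [barred_weight _ (n, false)]/barred_weight /= [RHS]addrC addKr.
apply: eq_bigl => -[k c]; rewrite !le_barredE xpair_eqE /=.
rewrite [k == n]eq_sym; case: c; rewrite /= ?andbF ?andbT ?orbF //.
by case: eqVneq => [->|]; rewrite ?ltxx //= orbF andbT.
Qed.

Lemma chain_sum_barred_cons (x : A) (s : seq A) (n : 'I_N) :
  spsum (x :: s) (n, false)
  = \sum_(k | (n <= k)%O)
      (t x k * spsum s (k, false) + t (- x) k * spsum s (k, true)).
Proof.
under [RHS]eq_bigr => k _ do
  rewrite addrC -(big_bool _ (fun c =>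
    barred_weight x (k, c) * spsum s (k, c))).
rewrite pair_big_dep /=.
by apply: eq_big => [[k c]|[k c] _] //=; rewrite le_barred_false andbT.
Qed.

Hypothesis tNM : forall x y k, t (- x) k * t y k = t (y - x) k.

(** Once the bounds [k] barred are eliminated, the correction they leave is a
    product of two powers of the same integer, that is, the weight of a merged
    entry. *)
Lemma chain_sum_barred_cons2 (x y : A) (s : seq A) (n : 'I_N) :
  spsum [:: x, y & s] (n, false)
  = \sum_(k | (n <= k)%O)
      ((t x k + t (- x) k) * spsum (y :: s) (k, false)
       - t (y - x) k * spsum s (k, false)).
Proof.
rewrite chain_sum_barred_cons; apply: eq_bigr => k _.
by rewrite chain_sum_bar mulrBr mulrA tNM mulrDl addrA.
Qed.

End Barred.

(** * The family of indices *)

Lemma big_fillings (C : nmodType) (n : nat) (H : seq bool -> C) :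
  \sum_(w <- fillings n) H w
  = \sum_(w : n.-tuple bool | sorted (fun a b => ~~ (a && b)) w) H w.
Proof. by rewrite /fillings big_map big_filter big_enum_cond. Qed.

Lemma big_selections_cons (C : nmodType) (T : Type) (c : seq T)
    (cs : seq (seq T)) (G : seq T -> C) :
  \sum_(l <- selections (c :: cs)) G l
  = \sum_(x <- c) \sum_(l <- selections cs) G (x :: l).
Proof. by rewrite /selections /= big_allpairs_dep. Qed.

Lemma size_selections (T : eqType) (cs : seq (seq T)) (l : seq T) :
  l \in selections cs -> size l = size cs.
Proof.
elim: cs l => [|c cs IHcs] l /=; first by rewrite inE => /eqP->.
by case/allpairsP => -[x l'] [_ /IHcs /= <- ->].
Qed.

Section Family.
Variable R : realType.
Implicit Types (s : seq R[i]) (x y : R[i]).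

Lemma size_alternatives s w : (size (alternatives s w) <= size s)%N.
Proof.
have [n] := ubnP (size s); elim: n s w => // n IHn [|x [|y s]] [|[] w] // sn.
- exact: (IHn (y :: s) [::] sn).
- by apply: leq_trans (IHn s (behead w) (ltnW sn)) _; apply: leqnSn.
- exact: (IHn (y :: s) w sn).
Qed.

Lemma size_Lfam s l : l \in Lfam s -> (size l <= size s)%N.
Proof.
case/flatten_mapP => w _ /size_selections ->; exact: size_alternatives.
Qed.

Lemma big_Lfam (C : nmodType) s (G : seq R[i] -> C) :
  \sum_(l <- Lfam s) G l
  = \sum_(w : (size s).-1.-tuple bool | sorted (fun a b => ~~ (a && b)) w)
      \sum_(l <- selections (alternatives s w)) G l.
Proof. by rewrite /Lfam big_flatten big_map big_fillings. Qed.

Lemma big_Lfam0 (C : nmodType) (G : seq R[i] -> C) :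
  \sum_(l <- Lfam [::]) G l = G [::].
Proof.
rewrite big_Lfam (big_pred1 [tuple]) ?big_seq1 // => w.
by rewrite [w]tuple0 /= eqxx.
Qed.

Lemma big_Lfam1 (C : nmodType) x (G : seq R[i] -> C) :
  \sum_(l <- Lfam [:: x]) G l = G [:: x] + G [:: - x].
Proof.
rewrite big_Lfam (big_pred1 [tuple]) => [|w]; last first.
  by rewrite [w]tuple0 /= eqxx.
by rewrite big_selections_cons big_cons !big_seq1.
Qed.

(** The fillings split by their first square.  After a plus the second square,
    if there is one, is a comma, and the rest is a filling for the entries that
    follow the merged pair. *)
Lemma big_Lfam_cons2 (C : nmodType) x y s (G : seq R[i] -> C) :
  \sum_(l <- Lfam [:: x, y & s]) G l
  = \sum_(l <- Lfam (y :: s)) (G (x :: l) + G (- x :: l))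
    + \sum_(l <- Lfam s) G (y - x :: l).
Proof.
have sorted_false w : sorted (fun a b => ~~ (a && b)) (false :: w)
    = sorted (fun a b => ~~ (a && b)) w by case: w.
rewrite !big_Lfam big_tuple_cons big_bool [LHS]addrC; congr (_ + _).
  apply: eq_big => [w|w _]; first exact: sorted_false.
  rewrite -[alternatives _ _]/([:: x; - x] :: alternatives (y :: s) w).
  by rewrite big_selections_cons big_cons big_seq1 big_split.
under eq_bigr => w _.
  rewrite -[alternatives _ _]/([:: y - x] :: alternatives s (behead w)).
  rewrite big_selections_cons big_seq1.
  over.
case: s => [|z s].
  by apply: eq_big => w //; rewrite [w]tuple0.
rewrite big_tuple_cons big_bool /= big_pred0_eq add0r.
by apply: eq_bigl => w; apply: sorted_false.
Qed.

End Family.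

(** * Symplectic rows *)

Section Symplectic.
Variables (R : realType) (N : nat) (C : comPzRingType) (t : R[i] -> 'I_N -> C).
Hypothesis tNM : forall x y k, t (- x) k * t y k = t (y - x) k.

Notation spsum := (chain_sum (<=%O : rel (barred N)) (barred_weight t)).
Notation starsum := (chain_sum (<=%O : rel 'I_N) t).

(** The exponent [size s + size l] has the parity of [size s - size l] but needs
    no comparison of the two sizes. *)
Definition star_sum (s : seq R[i]) (n : 'I_N) : C :=
  \sum_(l <- Lfam s) (-1) ^+ (size s + size l) * starsum l n.

Lemma star_sum_cons2 (x y : R[i]) (s : seq R[i]) (n : 'I_N) :
  star_sum [:: x, y & s] n
  = \sum_(k | (n <= k)%O)
      ((t x k + t (- x) k) * star_sum (y :: s) k - t (y - x) k * star_sum s k).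
Proof.
rewrite /star_sum big_Lfam_cons2 [RHS]big_split /=; congr (_ + _).
  under [RHS]eq_bigr do rewrite big_distrr /=.
  rewrite exchange_big /=; apply: eq_bigr => l _.
  rewrite -mulrDr -big_split /= big_distrr /=; apply: eq_bigr => k _.
  by rewrite addSn addnS !exprS !mulN1r opprK -mulrDl mulrCA.
under [RHS]eq_bigr do rewrite big_distrr /= -sumrN.
rewrite exchange_big /=; apply: eq_bigr => l _.
rewrite big_distrr /=; apply: eq_bigr => k _.
by rewrite !addSn addnS !exprS !mulN1r opprK mulNr mulrCA.
Qed.

(** Both sides obey the same recursion of depth two, hence the strong induction
    on the length of [s]. *)
Lemma chain_sum_barredE (s : seq R[i]) (n : 'I_N) :
  spsum s (n, false) = star_sum s n.
Proof.
have [m] := ubnP (size s); elim: m s n => // m IHm [|x [|y s]] n /= sm.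
- by rewrite /star_sum big_Lfam0 /= mulr1.
- rewrite -/(spsum [:: x] _) chain_sum_barred_cons /star_sum big_Lfam1 /=.
  by rewrite sqrrN !expr1n !mul1r -big_split.
rewrite -/(spsum [:: x, y & s] _) chain_sum_barred_cons2 // star_sum_cons2.
by apply: eq_bigr => k _; rewrite !IHm // ltnW.
Qed.

End Symplectic.

(** * Rows with a letter infinity *)

(** Increasing words in which infinity occurs at most once are the words that
    increase strictly at infinity. *)
Definition le_once (N : nat) (a b : option (barred N)) : bool :=
  (a != None) && le_barredoo a b.

Lemma path_le_once (N : nat) (a : option (barred N))
    (m : seq (option (barred N))) :
  path (@le_once N) a m
  = path (@le_barredoo N) a m && (count_mem None (a :: m) <= 1)%N.
Proof.
elim: m a => [|b m IHm] [a|] //=; first by rewrite IHm andbA.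
by case: b => [b|] //=; rewrite andbF.
Qed.

Section Infinity.
Variables (C : comPzRingType) (A : Type) (N : nat) (f : A -> barred N -> C).

Let foo (x : A) (a : option (barred N)) : C := if a is Some b then f x b else 1.

(** A word either ends with infinity, which leaves a word for the list without
    its last entry, or does not contain it. *)
Lemma chain_sum_infty (x : A) (s : seq A) (a : barred N) :
  chain_sum (@le_once N) foo (x :: s) (Some a)
  = chain_sum <=%O f (belast x s) a + chain_sum <=%O f (x :: s) a.
Proof.
have split_infty (F : option (barred N) -> C) b :
    \sum_(c | le_once (Some b) c) F c
    = F None + \sum_(c | (b <= c)%O) F (Some c).
  rewrite (bigD1 None) //=; congr (_ + _).
  rewrite (reindex_omap (@Some _) id) => [|[c|]] //=.
  by apply: eq_bigl => c; rewrite eqxx !andbT.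
elim: s x a => [|y s IHs] x a; rewrite [LHS]/= split_infty.
  by congr (_ + _); rewrite mulr1.
(* A word that continues after infinity does not exist. *)
rewrite big_pred0 // mulr0 add0r /= -big_split /=.
by apply: eq_bigr => b _; rewrite -mulrDr -IHs.
Qed.

End Infinity.

(** * Complex powers *)

Section Powers.
Variable R : realType.

Lemma cexpD (z w : R[i]) : cexp (z + w) = cexp z * cexp w.
Proof.
case: z w => [a b] [c d]; rewrite /cexp /= expRD cosD sinD.
simpc; congr (_ +i* _).
  by rewrite !mulrBr -!mulrA; congr (_ * _ - _ * _); rewrite mulrCA.
rewrite !mulrDr addrC; congr (_ + _).
  by rewrite -!mulrA; congr (_ * _); rewrite mulrCA.
by rewrite -!mulrA; congr (_ * _); rewrite mulrCA.
Qed.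

Lemma cpowD (x : R) (z w : R[i]) : cpow x (z + w) = cpow x z * cpow x w.
Proof. by rewrite /cpow mulrDl cexpD. Qed.

Lemma cpow1 (z : R[i]) : cpow 1 z = 1.
Proof. by rewrite /cpow ln1 mulr0 /cexp /= expR0 cos0 sin0 mul1r. Qed.

Lemma cpowV (x : R) (z : R[i]) : 0 < x -> cpow x^-1 z = cpow x (- z).
Proof. by move=> x0; rewrite /cpow lnV ?posrE // rmorphN /= mulrN mulNr. Qed.

End Powers.

(** * The zeta sums as iterated sums *)

Section Zeta.
Variables (R : realType) (N : nat).

Definition star_weight (x : R[i]) (n : 'I_N) : R[i] := cpow n.+1%:R (- x).

Lemma barred_weightE (x : R[i]) (a : barred N) :
  cpow (barred_abs R a) (- x) = barred_weight star_weight x a.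
Proof.
case: a => n []; rewrite /barred_abs /barred_weight /star_weight //=.
by rewrite cpowV ?ltr0Sn.
Qed.

Lemma star_weightNM (x y : R[i]) (n : 'I_N) :
  star_weight (- x) n * star_weight y n = star_weight (y - x) n.
Proof. by rewrite /star_weight -cpowD opprB opprK. Qed.

Variable n0 : 'I_N.
Hypothesis n0E : n0 = 0%N :> nat.

Lemma least_ord (k : 'I_N) : (n0 <= k)%O.
Proof. by rewrite leEord n0E. Qed.

Lemma least_barred (a : barred N) : ((n0, false) <= a :> barred N)%O.
Proof. by case: a => k c; rewrite le_barred_false least_ord. Qed.

Lemma zeta_starE (l : seq R[i]) :
  zeta_star N l = chain_sum <=%O star_weight l n0.
Proof.
rewrite /zeta_star -[RHS](chain_sumE _ _ (in_tuple l)).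
apply: eq_bigl => m; rewrite path_min_sorted //.
by apply/allP => k _; apply: least_ord.
Qed.

Lemma zeta_spE (r : nat) (s : r.-tuple R[i]) :
  zeta_sp N s = chain_sum <=%O (barred_weight star_weight) s (n0, false).
Proof.
rewrite /zeta_sp -chain_sumE; apply: eq_big => [m|m _].
  by rewrite path_min_sorted //; apply/allP => k _; apply: least_barred.
by apply: eq_bigr => j _; rewrite barred_weightE.
Qed.

Lemma zeta_soE (r : nat) (s : r.-tuple R[i]) :
  zeta_so N s
  = chain_sum (@le_once N)
      (fun x a => if a is Some b then barred_weight star_weight x b else 1)
      s (Some (n0, false)).
Proof.
rewrite /zeta_so -chain_sumE; apply: eq_big => [m|m _].
  rewrite path_le_once /= path_min_sorted //.
  by apply/allP => -[a|] _ //; apply: least_barred.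
apply: eq_bigr => j _; case: (tnth m j) => [a|] /=; first exact: barred_weightE.
exact: cpow1.
Qed.

Lemma sum_Lfam_zeta_star (s : seq R[i]) :
  \sum_(l <- Lfam s) (-1) ^+ (size s - dep l)%N * zeta_star N l
  = chain_sum <=%O (barred_weight star_weight) s (n0, false).
Proof.
rewrite (chain_sum_barredE star_weightNM) /star_sum.
apply: eq_big_seq => l /size_Lfam ls; rewrite -zeta_starE; congr (_ * _).
by rewrite -signr_odd oddB // -oddD signr_odd.
Qed.

End Zeta.

Theorem theorem9p5 (R : realType) (N r : nat) (hN : (0 < N)%N) (hr : (0 < r)%N)
    (s : r.-tuple R[i]) :
  zeta_sp N s = \sum_(l <- Lfam s) (-1) ^+ (r - dep l)%N * zeta_star N l
  /\ ((2 <= r)%N ->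
      zeta_so N s =
        \sum_(r.-1 <= k < r.+1) \sum_(l <- Lfam (take k s))
          (-1) ^+ (k - dep l)%N * zeta_star N l).
Proof.
have n0E : Ordinal hN = 0%N :> nat by [].
have sumE k : (k <= r)%N ->
    \sum_(l <- Lfam (take k s)) (-1) ^+ (k - dep l)%N * zeta_star N l
    = chain_sum <=%O (barred_weight (@star_weight R N)) (take k s)
        (Ordinal hN, false).
  move=> kr; rewrite -(sum_Lfam_zeta_star n0E) size_takel ?size_tuple //.
have take_s : take r s = s by rewrite take_oversize ?size_tuple.
split=> [|_]; first by rewrite (zeta_spE n0E) -{1}take_s -sumE // take_s.
rewrite (zeta_soE n0E).
case: r hr s sumE take_s => // r _ s sumE take_s /=.
rewrite big_nat_recr // big_nat1 /= !sumE // take_s.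
case/tupleP: s {sumE take_s} => x s /=.
rewrite -/(chain_sum _ _ (x :: s) _) chain_sum_infty.
rewrite [in RHS](_ : take _ _ = belast x s) // lastI -cats1.
by rewrite take_size_cat // size_belast size_tuple.
Qed.
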